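(* Let $K$ be a field and let $A=KQ/I$ be a finite dimensional indecomposable $K$-algebra with $I$ an admissible ideal of the path algebra $KQ$. Suppose that the socle of $A$ is arrow-free, and set $\Pi=\{ab\mid a,b\in Q_1,\ ab\notin I\}$. Then the following are equivalent: (1) Condition (M) holds: for every arrow $a$ in $Q$ there is at most one arrow $b$ in $Q$ such that $ab\notin I$ and at most one arrow $c$ in $Q$ such that $ca\notin I$ (that is, $A=KQ/I$ is special multiserial). (2) Condition (M$'$) holds: for every arrow $a$ in $Q$ there exists exactly one arrow $b$ in $Q$ such that $ab\notin I$ and exactly one arrow $c$ in $Q$ such that $ca\notin I$. (3) The map $\varphi\colon\Pi\to Q_1$ given by $\varphi(ab)=a$ is bijective. (4) The map $\psi\colon\Pi\to Q_1$ given by $\psi(ab)=b$ is bijective. (5) There exists a special set of cycles in $Q$.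
   Context: $Q_1$ is the set of arrows of $Q$; $ab$ denotes the path $a$ followed by $b$ (zero in $KQ$ if not composable). For $a\in Q_1$ let $\bar a$ be its image in $A$. The socle of $A$ is arrow-free if, for each $a\in Q_1$, $\bar a\notin\operatorname{soc}({}_AA)$ and $\bar a\notin\operatorname{soc}(A_A)$, where ${}_AA$ and $A_A$ are $A$ as a left, respectively right, module. A cycle in $Q$ is basic if it has no repeated arrows. A set $\{C_1,\dots,C_r\}$ of basic cycles is special if (i) each arrow $a$ in $Q$ occurs in exactly one $C_i$, $i=1,\dots,r$; and (ii) a path $ab$ of length 2 is in $\Pi$ if and only if $ab$ is a subpath of some cycle $C_i=c_1\cdots c_n$, where $c_nc_1$ is also considered a subpath of $C_i$. *)

(* Defs.v *)
From HB Require Import structures.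
From mathcomp Require Import all_boot all_order all_algebra falgebra.
From mathcomp Require Import finmap monalg.

Set Implicit Arguments.
Unset Strict Implicit.
Unset Printing Implicit Defensive.

Import GRing.Theory.
Local Open Scope ring_scope.

(* Quivers are finite, as is customary when KQ/I is finite dimensional with
   I admissible.  Loops and parallel arrows are allowed. *)
Record quiver := Quiver {
  vertex : finType;
  arrow : finType;
  src : arrow -> vertex;
  tgt : arrow -> vertex
}.

Section Paths.
Variable Q : quiver.

Fixpoint is_walk (v : vertex Q) (s : seq (arrow Q)) : bool :=
  if s is a :: s' then (src a == v) && is_walk (tgt a) s' else true.

(* A path is its starting vertex with its list of arrows, read from left to
   right; the vertex matters only for the trivial paths (v, [::]). *)
Record qpath := QPath {
  qpath_val : vertex Q * seq (arrow Q);
  _ : is_walk qpath_val.1 qpath_val.2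
}.
HB.instance Definition _ := [isSub for qpath_val].
HB.instance Definition _ := [Choice of qpath by <:].

Definition psrc (p : qpath) : vertex Q := (val p).1.
Definition parr (p : qpath) : seq (arrow Q) := (val p).2.
Definition ptgt (p : qpath) : vertex Q := last (psrc p) (map (@tgt Q) (parr p)).

Definition triv_path (v : vertex Q) : qpath := @QPath (v, [::]) isT.

Fact arrow_path_subproof (a : arrow Q) : is_walk (src a) [:: a].
Proof. by rewrite /= eqxx. Qed.
Definition arrow_path (a : arrow Q) : qpath :=
  @QPath (src a, [:: a]) (arrow_path_subproof a).

(* p followed by q, or None if they are not composable; by [pcatE] below,
   insub succeeds whenever the test does. *)
Definition pcat (p q : qpath) : option qpath :=
  if ptgt p == psrc q then insub (psrc p, parr p ++ parr q) else None.

Lemma is_walk_cat v s1 s2 :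
  is_walk v (s1 ++ s2) =
  is_walk v s1 && is_walk (last v (map (@tgt Q) s1)) s2.
Proof. by elim: s1 v => //= a s1 IH v; rewrite IH andbA. Qed.

Lemma pcatE p q :
  omap val (pcat p q) =
  if ptgt p == psrc q then Some (psrc p, parr p ++ parr q) else None.
Proof.
rewrite /pcat; case: eqP => //= epq; case: insubP => [r _ vr|]; first by rewrite /= vr.
rewrite /= is_walk_cat (valP p) -/(ptgt p) epq; case/negP; exact: (valP q).
Qed.

Lemma pcat_some p q r : pcat p q = Some r ->
  [/\ ptgt p = psrc q, psrc r = psrc p, parr r = parr p ++ parr q
    & ptgt r = ptgt q].
Proof.
move=> e; have := pcatE p q; rewrite e; case: eqP => //= epq [E].
have Es : psrc r = psrc p by rewrite /psrc /= E.
have Ea : parr r = parr p ++ parr q by rewrite {1}/parr /= E.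
by split=> //; rewrite /ptgt Es Ea map_cat last_cat -/(ptgt p) epq.
Qed.

Lemma pcat_none p q : pcat p q = None -> (ptgt p == psrc q) = false.
Proof. by move=> e; have := pcatE p q; rewrite e; case: eqP. Qed.

Lemma pcatA p q r : obind (pcat p) (pcat q r) = obind (pcat^~ r) (pcat p q).
Proof.
apply: (inj_omap (@val_inj _ _ qpath)).
case Eqr: (pcat q r) => [s|]; case Epq: (pcat p q) => [t|] //=.
- have [e1 s1 a1 _] := pcat_some Eqr; have [e2 s2 a2 t2] := pcat_some Epq.
  by rewrite !pcatE s1 a1 t2 s2 a2 e1 e2 !eqxx catA.
- have [_ s1 _ _] := pcat_some Eqr.
  by rewrite pcatE s1 (pcat_none Epq).
- have [_ _ _ t2] := pcat_some Epq.
  by rewrite pcatE t2 (pcat_none Eqr).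
Qed.

Lemma pcat1p v p : pcat (triv_path v) p = if v == psrc p then Some p else None.
Proof.
apply: (inj_omap (@val_inj _ _ qpath)).
rewrite pcatE /ptgt /=; case: eqP => //= ->.
by rewrite /psrc /parr -surjective_pairing.
Qed.

Lemma pcatp1 v p : pcat p (triv_path v) = if v == ptgt p then Some p else None.
Proof.
apply: (inj_omap (@val_inj _ _ qpath)).
rewrite pcatE /= [v == _]eq_sym; case: eqP => //= _.
by rewrite cats0 /psrc /parr -surjective_pairing.
Qed.

End Paths.

(* The path algebra KQ: finitely supported K-valued functions on paths. *)
Definition pathalg (K : fieldType) (Q : quiver) : Type := {malg K[qpath Q]}.

HB.instance Definition _ (K : fieldType) (Q : quiver) :=
  GRing.Zmodule.copy (pathalg K Q) {malg K[qpath Q]}.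

(* Locked, like the basis elements and the product below, because unification
   otherwise unfolds sums over supports, which is very slow. *)
HB.lock Definition pathalg_scale (K : fieldType) (Q : quiver)
    (c : K) (x : pathalg K Q) : pathalg K Q := c *: (x : {malg K[qpath Q]}).

HB.lock Definition pelt (K : fieldType) (Q : quiver) (p : qpath Q) :
  pathalg K Q := << p >>.

Definition pmul_path (K : fieldType) (Q : quiver) (p q : qpath Q) :
    pathalg K Q :=
  if pcat p q is Some r then pelt K r else 0.

Section Lmodule.
Variables (K : fieldType) (Q : quiver).

Let coefZ (c : K) (x : pathalg K Q) p : (pathalg_scale c x)@_p = c * x@_p.
Proof. by rewrite unlock mcoeffZ. Qed.

Fact pathalg_scaleA (c d : K) (x : pathalg K Q) :
  pathalg_scale c (pathalg_scale d x) = pathalg_scale (c * d) x.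
Proof. by apply/malgP => p; rewrite !coefZ mulrA. Qed.

Fact pathalg_scale1 : left_id 1 (@pathalg_scale K Q).
Proof. by move=> x; apply/malgP => p; rewrite coefZ mul1r. Qed.

Fact pathalg_scaleDr : right_distributive (@pathalg_scale K Q) +%R.
Proof.
by move=> c x y; apply/malgP => p; rewrite [RHS]mcoeffD !coefZ mcoeffD mulrDr.
Qed.

Fact pathalg_scaleDl (x : pathalg K Q) :
  {morph (@pathalg_scale K Q)^~ x : c d / c + d}.
Proof.
by move=> c d; apply/malgP => p; rewrite [RHS]mcoeffD !coefZ mulrDl.
Qed.

HB.instance Definition _ := GRing.Zmodule_isLmodule.Build K (pathalg K Q)
  pathalg_scaleA pathalg_scale1 pathalg_scaleDr pathalg_scaleDl.

Lemma pathalg_coefZ (c : K) (x : pathalg K Q) p : (c *: x)@_p = c * x@_p.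
Proof. exact: coefZ. Qed.

Lemma pathalg_suppZ (c : K) (x : pathalg K Q) :
  (msupp (c *: x) `<=` msupp x)%fset.
Proof.
apply/fsubsetP => p; rewrite -!mcoeff_neq0 pathalg_coefZ.
by apply: contraNneq => ->; rewrite mulr0.
Qed.

End Lmodule.

HB.lock Definition pathalg_mul (K : fieldType) (Q : quiver)
    (x y : pathalg K Q) : pathalg K Q :=
  \sum_(p <- msupp x) \sum_(q <- msupp y) (x@_p * y@_q) *: pmul_path K p q.

Section PathAlgebra.
Variables (K : fieldType) (Q : quiver).
Local Notation KQ := (pathalg K Q).
Local Notation pelt := (@pelt K Q).
Local Notation pmul_path := (@pmul_path K Q).
Local Notation pathalg_mul := (@pathalg_mul K Q).
Implicit Types (x y z : KQ) (p q r : qpath Q).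

Definition pathalg_one : KQ := \sum_(v : vertex Q) pelt (triv_path v).

Local Open Scope fset_scope.
Local Open Scope ring_scope.

Lemma pathalg_mulEw (d1 d2 : {fset qpath Q}) x y :
  msupp x `<=` d1 -> msupp y `<=` d2 ->
  pathalg_mul x y =
  \sum_(p <- d1) \sum_(q <- d2) (x@_p * y@_q) *: pmul_path p q.
Proof.
move=> le1 le2; rewrite unlock (big_fset_incl _ le1) /=.
  apply: eq_bigr => p _; apply: big_fset_incl => // q _ /mcoeff_outdom ->.
  by rewrite mulr0 scale0r.
move=> p _ /mcoeff_outdom xp.
by rewrite big1 => // q _; rewrite xp mul0r scale0r.
Qed.

Lemma pathalg_mulDl : left_distributive pathalg_mul +%R.
Proof.
move=> x y z.
rewrite (pathalg_mulEw (msuppD_le x y) (fsubset_refl (msupp z))).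
rewrite (pathalg_mulEw (fsubsetUl (msupp x) (msupp y)) (fsubset_refl (msupp z))).
rewrite (pathalg_mulEw (fsubsetUr (msupp x) (msupp y)) (fsubset_refl (msupp z))).
rewrite -big_split /=; apply: eq_bigr => p _.
rewrite -big_split /=; apply: eq_bigr => q _.
by rewrite mcoeffD mulrDl scalerDl.
Qed.

Lemma pathalg_mulDr : right_distributive pathalg_mul +%R.
Proof.
move=> z x y.
rewrite (pathalg_mulEw (fsubset_refl (msupp z)) (msuppD_le x y)).
rewrite (pathalg_mulEw (fsubset_refl (msupp z)) (fsubsetUl (msupp x) (msupp y))).
rewrite (pathalg_mulEw (fsubset_refl (msupp z)) (fsubsetUr (msupp x) (msupp y))).
rewrite -big_split /=; apply: eq_bigr => p _.
rewrite -big_split /=; apply: eq_bigr => q _.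
by rewrite mcoeffD mulrDr scalerDl.
Qed.

Lemma pathalg_scaleAl (c : K) x y : c *: pathalg_mul x y = pathalg_mul (c *: x) y.
Proof.
rewrite (pathalg_mulEw (pathalg_suppZ c x) (fsubset_refl (msupp y))).
rewrite unlock scaler_sumr; apply: eq_bigr => p _.
rewrite scaler_sumr; apply: eq_bigr => q _.
by rewrite scalerA pathalg_coefZ mulrA.
Qed.

Lemma pathalg_scaleAr (c : K) x y : c *: pathalg_mul x y = pathalg_mul x (c *: y).
Proof.
rewrite (pathalg_mulEw (fsubset_refl (msupp x)) (pathalg_suppZ c y)).
rewrite unlock scaler_sumr; apply: eq_bigr => p _.
rewrite scaler_sumr; apply: eq_bigr => q _.
by rewrite scalerA pathalg_coefZ mulrCA.
Qed.

Lemma pathalg_mul0l x : pathalg_mul 0 x = 0.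
Proof. by rewrite unlock msupp0 big_seq_fset0. Qed.

Lemma pathalg_mul0r x : pathalg_mul x 0 = 0.
Proof. by rewrite unlock big1 // => p _; rewrite msupp0 big_seq_fset0. Qed.

Lemma pathalg_suml (I : Type) (s : seq I) (F : I -> KQ) y :
  pathalg_mul (\sum_(i <- s) F i) y = \sum_(i <- s) pathalg_mul (F i) y.
Proof.
exact: (big_morph (pathalg_mul^~ y) (fun _ _ => pathalg_mulDl _ _ _)
                  (pathalg_mul0l y)).
Qed.

Lemma pathalg_sumr (I : Type) (s : seq I) (F : I -> KQ) y :
  pathalg_mul y (\sum_(i <- s) F i) = \sum_(i <- s) pathalg_mul y (F i).
Proof.
exact: (big_morph (pathalg_mul y) (fun _ _ => pathalg_mulDr _ _ _)
                  (pathalg_mul0r y)).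
Qed.

Lemma pelt_coef p q : (pelt p)@_q = (p == q)%:R.
Proof. by rewrite unlock mcoeffU. Qed.

Lemma pathalg_mulpp p q : pathalg_mul (pelt p) (pelt q) = pmul_path p q.
Proof.
rewrite (pathalg_mulEw (d1 := [fset p]) (d2 := [fset q])).
- by rewrite !big_seq_fset1 !pelt_coef !eqxx mulr1 scale1r.
- by rewrite unlock msuppU_le.
- by rewrite unlock msuppU_le.
Qed.

Lemma pathalgE x : x = \sum_(p <- msupp x) x@_p *: pelt p.
Proof.
rewrite {1}[x]monalgE; apply: eq_bigr => p _.
by apply/malgP => q; rewrite [RHS]pathalg_coefZ [LHS]mcoeffU [X in _ * X]pelt_coef mulr_natr.
Qed.

Lemma pathalg_ind (P : KQ -> Prop) :
  P 0 -> (forall x y, P x -> P y -> P (x + y)) ->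
  (forall c p, P (c *: pelt p)) -> forall x, P x.
Proof.
by move=> P0 PD PZ x; rewrite [x]pathalgE; apply: big_ind => // p _; apply: PZ.
Qed.

Lemma pathalg_mulA : associative pathalg_mul.
Proof.
move=> x y z; elim/pathalg_ind: x => [|x x' IH IH'|c p].
- by rewrite !pathalg_mul0l.
- by rewrite !pathalg_mulDl IH IH'.
rewrite -!pathalg_scaleAl; congr (_ *: _).
elim/pathalg_ind: y => [|y y' IH IH'|c' q].
- by rewrite !(pathalg_mul0l, pathalg_mul0r).
- by rewrite !(pathalg_mulDl, pathalg_mulDr) IH IH'.
rewrite -pathalg_scaleAl -!pathalg_scaleAr -pathalg_scaleAl; congr (_ *: _).
elim/pathalg_ind: z => [|z z' IH IH'|c'' r].
- by rewrite !pathalg_mul0r.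
- by rewrite !pathalg_mulDr IH IH'.
rewrite -!pathalg_scaleAr; congr (_ *: _).
rewrite !pathalg_mulpp /pmul_path.
have := pcatA p q r.
case: (pcat q r) => [s|]; case: (pcat p q) => [t|];
  rewrite ?pathalg_mul0l ?pathalg_mul0r ?pathalg_mulpp /pmul_path /= => E //.
- by rewrite E.
- by rewrite E.
- by rewrite -E.
Qed.

Lemma pathalg_mul1l : left_id pathalg_one pathalg_mul.
Proof.
elim/pathalg_ind => [|x y IH IH'|c p]; first by rewrite pathalg_mul0r.
  by rewrite pathalg_mulDr IH IH'.
rewrite -pathalg_scaleAr; congr (_ *: _).
rewrite pathalg_suml (bigD1 (psrc p)) //= pathalg_mulpp /pmul_path pcat1p eqxx.
rewrite big1 ?addr0 // => v /negbTE nv.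
by rewrite pathalg_mulpp /pmul_path pcat1p nv.
Qed.

Lemma pathalg_mul1r : right_id pathalg_one pathalg_mul.
Proof.
elim/pathalg_ind => [|x y IH IH'|c p]; first by rewrite pathalg_mul0l.
  by rewrite pathalg_mulDl IH IH'.
rewrite -pathalg_scaleAl; congr (_ *: _).
rewrite pathalg_sumr (bigD1 (ptgt p)) //= pathalg_mulpp /pmul_path pcatp1 eqxx.
rewrite big1 ?addr0 // => v /negbTE nv.
by rewrite pathalg_mulpp /pmul_path pcatp1 nv.
Qed.

(* Only a possibly zero ring: KQ = 0 when Q has no vertex.  MathComp's algebra
   structures require 1 != 0, hence no algType instance here; compatibility
   with scaling is [pathalg_scaleAl] and [pathalg_scaleAr]. *)
HB.instance Definition _ := GRing.Zmodule_isPzRing.Build KQ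
  pathalg_mulA pathalg_mul1l pathalg_mul1r pathalg_mulDl pathalg_mulDr.

Definition arr (a : arrow Q) : KQ := pelt (arrow_path a).

End PathAlgebra.

Section Ideals.
Variable R : pzRingType.

Definition two_sided_ideal (I : {pred R}) : Prop :=
  [/\ 0 \in I,
      forall x y, x \in I -> y \in I -> x - y \in I,
      forall a x, x \in I -> a * x \in I
    & forall a x, x \in I -> x * a \in I].

Definition ideal_prod (I J : R -> Prop) (x : R) : Prop :=
  exists2 s : seq (R * R),
    forall u, u \in s -> I u.1 /\ J u.2 & x = \sum_(u <- s) u.1 * u.2.

Fixpoint ideal_pow (J : R -> Prop) (n : nat) : R -> Prop :=
  if n is n'.+1 then ideal_prod J (ideal_pow J n') else fun=> True.

End Ideals.

Section Admissible.
Variables (K : fieldType) (Q : quiver).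
Local Notation KQ := (pathalg K Q).

(* The two-sided ideal generated by the arrows. *)
Definition arrow_ideal (x : KQ) : Prop :=
  exists s : seq (KQ * arrow Q * KQ),
    x = \sum_(u <- s) u.1.1 * arr K u.1.2 * u.2.

Definition admissible (I : {pred KQ}) : Prop :=
  [/\ two_sided_ideal I,
      forall x, x \in I -> ideal_pow arrow_ideal 2 x
    & exists2 n : nat, (2 <= n)%N &
        forall x, ideal_pow arrow_ideal n x -> x \in I].

(* pi exhibits A as the K-algebra KQ/I: it is a surjective K-algebra morphism
   with kernel I. *)
Definition is_quotient (I : {pred KQ}) (A : falgType K)
    (pi : {rmorphism KQ -> A}) : Prop :=
  [/\ scalable pi, forall y : A, exists x : KQ, pi x = y
    & forall x : KQ, (x \in I) = (pi x == 0)].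

End Admissible.

Section FiniteDimensionalAlgebra.
Variables (K : fieldType) (A : falgType K).
Implicit Types (U W B C : {vspace A}) (x : A).

(* Submodules of A are K-subspaces since A is unital. *)
Definition lsubmod U : Prop := forall a u : A, u \in U -> a * u \in U.
Definition rsubmod U : Prop := forall a u : A, u \in U -> u * a \in U.

Definition simple_sub (sub : {vspace A} -> Prop) U : Prop :=
  [/\ sub U, U <> 0%VS
    & forall W, sub W -> (W <= U)%VS -> W = 0%VS \/ W = U].

(* Membership in the sum of all simple submodules. *)
Definition in_socle (sub : {vspace A} -> Prop) x : Prop :=
  exists2 s : seq {vspace A},
    forall U, U \in s -> simple_sub sub U & x \in (\sum_(U <- s) U)%VS.

Definition left_socle x : Prop := in_socle lsubmod x.
Definition right_socle x : Prop := in_socle rsubmod x.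

(* A is not a direct product of two nonzero algebras, i.e. not a direct sum of
   two nonzero two-sided ideals; A is nonzero because it is a falgType. *)
Definition indecomposable_alg : Prop :=
  forall B C, lsubmod B -> rsubmod B -> lsubmod C -> rsubmod C ->
    (B + C)%VS = fullv -> (B :&: C)%VS = 0%VS -> B = 0%VS \/ C = 0%VS.

End FiniteDimensionalAlgebra.

Section Conditions.
Variables (K : fieldType) (Q : quiver).
Local Notation KQ := (pathalg K Q).

Definition arrow_free_socle (A : falgType K) (pi : {rmorphism KQ -> A}) : Prop :=
  forall a : arrow Q,
    ~ left_socle (pi (arr K a)) /\ ~ right_socle (pi (arr K a)).

Variable I : {pred KQ}.

Definition nonzero_prod (a b : arrow Q) : bool := arr K a * arr K b \notin I.

Definition condM : Prop :=
  forall a : arrow Q,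
    (forall b b', nonzero_prod a b -> nonzero_prod a b' -> b = b') /\
    (forall c c', nonzero_prod c a -> nonzero_prod c' a -> c = c').

Definition condM' : Prop :=
  forall a : arrow Q,
    (exists! b, nonzero_prod a b) /\ (exists! c, nonzero_prod c a).

(* The set Pi.  If ab is not in I then it is a path of length 2, which
   determines the pair (a, b). *)
Definition Pi_set : Type :=
  {ab : arrow Q * arrow Q | nonzero_prod ab.1 ab.2}.

Definition phi (ab : Pi_set) : arrow Q := (val ab).1.
Definition psi (ab : Pi_set) : arrow Q := (val ab).2.

Definition is_cycle (c : seq (arrow Q)) : bool :=
  (c != [::]) && cycle (fun a b => tgt a == src b) c.

Definition basic_cycle (c : seq (arrow Q)) : bool := is_cycle c && uniq c.

(* For c = c_1 ... c_n, this is: ab is a subpath of c_1 ... c_n c_1. *)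
Definition cyc_subpath (a b : arrow Q) (c : seq (arrow Q)) : bool :=
  infix [:: a; b] (c ++ take 1 c).

Definition special_cycles (S : {fset seq (arrow Q)}) : Prop :=
  [/\ forall c, c \in S -> basic_cycle c,
      forall a : arrow Q, exists! c, c \in S /\ a \in c
    & forall a b : arrow Q, tgt a = src b ->
        (nonzero_prod a b <-> exists2 c, c \in S & cyc_subpath a b c)].

End Conditions.

(* Main.v *)
Require Import Defs.
From HB Require Import structures.
From mathcomp Require Import all_boot all_order all_algebra falgebra.
From mathcomp Require Import finmap monalg.

Set Implicit Arguments.
Unset Strict Implicit.
Unset Printing Implicit Defensive.

(** If [ca] is in [I] for every arrow [c], then the left ideal of [A] generated
    by the image of [a] is the line spanned by it, hence lies in the socle.  So
    an arrow-free socle says that every arrow can be extended on both sides by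
    an arrow to a path of length 2 outside [I].  The relation [ab \notin I] on
    the finite set of arrows is then total on both sides, so as soon as it is
    functional in one direction it is the graph of a permutation, and the
    cycles of this permutation are the special cycles. *)

Import GRing.Theory.
Local Open Scope ring_scope.

(** Totality on the right makes the chosen [f] surjective, and a surjective self-map of a finite set
    is injective. *)
Lemma total_functional_rel (T : finType) (r : rel T) :
  (forall a, exists b, r a b) -> (forall b, exists a, r a b) ->
  (forall a b b', r a b -> r a b' -> b = b') ->
  exists2 f : T -> T, injective f & r =2 frel f.
Proof.
move=> rl rr rf; pose f a := xchoose (rl a).
have rE : r =2 frel f.
  move=> a b; apply/idP/eqP => [rab|<-]; last exact: xchooseP.
  by apply: rf rab; apply: xchooseP.
exists f => //; pose g b := xchoose (rr b).
have gK : cancel g f by move=> b; have := xchooseP (rr b); rewrite rE => /eqP.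
(* [g] is an injective self-map of a finite set, hence bijective, so its left inverse [f] is a
   two-sided inverse. *)
exact: (can_inj ((bij_can_sym (injF_bij (can_inj gK)) f).2 gK)).
Qed.

(** The converse relation is the graph of a permutation [g], so [r] is the graph of its inverse. *)
Lemma total_cofunctional_rel (T : finType) (r : rel T) :
  (forall a, exists b, r a b) -> (forall b, exists a, r a b) ->
  (forall a a' b, r a b -> r a' b -> a = a') ->
  exists2 f : T -> T, injective f & r =2 frel f.
Proof.
move=> rl rr rf.
have [|g gI rE] := total_functional_rel (r := fun b a => r a b) rr rl.
  by move=> b a a'; apply: rf.
exists (invF gI); first exact: can_inj (f_invF gI).
move=> a b; rewrite (rE b a) /=.
by apply/eqP/eqP => [<-|<-]; rewrite ?invF_f ?f_invF.
Qed.

Section Socle.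
Variables (K : fieldType) (A : falgType K).

(** By dimension, a line has no proper nonzero subspace, so it is simple as soon as it is a
    submodule. For [x = 0] the empty sum of simple submodules suffices. *)
Lemma in_socle_line (sub : {vspace A} -> Prop) (x : A) :
  sub <[x]>%VS -> in_socle sub x.
Proof.
move=> subx; have [->|x0] := eqVneq x 0; first by exists [::]; rewrite ?mem0v.
exists [:: <[x]>%VS]; last by rewrite big_seq1 memv_line.
move=> U; rewrite inE => /eqP->; split=> // [/eqP|W _ sWx].
  by rewrite -dimv_eq0 dim_vline x0.
have [->|W0] := eqVneq W 0%VS; [by left | right].
by apply/eqP; rewrite eqEdim sWx dim_vline x0 lt0n dimv_eq0.
Qed.

End Socle.

Section PathFactor.
Variables (K : fieldType) (Q : quiver).

(** Isolates the arrow of [p] that meets [a] in a product of [p] with an arrow [a] on its right. *)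
Lemma pelt_rcons (p : qpath Q) s c : parr p = rcons s c ->
  exists q, pelt K p = pelt K q * arr K c.
Proof.
case: p => [[v t] w] /= tE; rewrite /parr /= in tE; subst t.
have /andP[ws /eqP sc] : is_walk v s && (src c == last v (map (@tgt Q) s)).
  by move: w; rewrite /= -cats1 is_walk_cat /= andbT.
exists (@QPath Q (v, s) ws); rewrite /arr [RHS]pathalg_mulpp /pmul_path.
have := pcatE (@QPath Q (v, s) ws) (arrow_path c).
rewrite /ptgt /psrc /parr /= sc eqxx cats1.
by case: pcat => [r|] //= [rE]; congr pelt; apply: val_inj.
Qed.

Lemma pelt_cons (p : qpath Q) s c : parr p = c :: s ->
  exists q, pelt K p = arr K c * pelt K q.
Proof.
case: p => [[v t] w] /= tE; rewrite /parr /= in tE; subst t.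
have /andP[/eqP sc ws] : (src c == v) && is_walk (tgt c) s by [].
exists (@QPath Q (tgt c, s) ws); rewrite /arr [RHS]pathalg_mulpp /pmul_path.
have := pcatE (arrow_path c) (@QPath Q (tgt c, s) ws).
rewrite /ptgt /psrc /parr /= eqxx sc.
by case: pcat => [r|] //= [rE]; congr pelt; apply: val_inj.
Qed.

Lemma triv_pathE (p : qpath Q) : parr p = [::] -> p = triv_path (psrc p).
Proof. by case: p => [[v t] w] /= tE; apply: val_inj; rewrite /= -tE. Qed.

End PathFactor.

Section Quotient.
Variables (K : fieldType) (Q : quiver) (I : {pred pathalg K Q}).
Variables (A : falgType K) (pi : {rmorphism pathalg K Q -> A}).
Hypothesis hA : is_quotient I pi.

(** Suppose that there is no such [c]. By linearity it is enough to multiply [a] on the left by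
    paths: a trivial path gives [a] or 0, and any other path ends in an arrow [c] with [ca] in [I],
    which gives 0 in [A]. The line of [a] is thus a left submodule. *)
Lemma exists_nonzero_prod_left (a : arrow Q) :
  ~ left_socle (pi (arr K a)) -> exists c, nonzero_prod I c a.
Proof.
case: hA => piZ pi_surj piI nsoc.
case: (boolP [exists c, nonzero_prod I c a]) => [/existsP //|/existsPn no_c].
case: nsoc; apply: in_socle_line => y _ /vlineP[k ->]; rewrite -scalerAr memvZ //.
have [x <-] := pi_surj y; elim/pathalg_ind: x => [|x x' IH IH'|d p].
- by rewrite raddf0 mul0r mem0v.
- by rewrite raddfD mulrDl memvD.
rewrite piZ -scalerAl memvZ // -rmorphM.
case/lastP E: (parr p) => [|s c].
  rewrite [_ * _]pathalg_mulpp /pmul_path (triv_pathE E) pcat1p.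
  by case: eqP => _; rewrite ?memv_line // raddf0 mem0v.
have [q ->] := pelt_rcons K E; have := no_c c.
by rewrite negbK -mulrA rmorphM piI => /eqP->; rewrite mulr0 mem0v.
Qed.

Lemma exists_nonzero_prod_right (a : arrow Q) :
  ~ right_socle (pi (arr K a)) -> exists b, nonzero_prod I a b.
Proof.
case: hA => piZ pi_surj piI nsoc.
case: (boolP [exists c, nonzero_prod I a c]) => [/existsP //|/existsPn no_c].
case: nsoc; apply: in_socle_line => y _ /vlineP[k ->]; rewrite -scalerAl memvZ //.
have [x <-] := pi_surj y; elim/pathalg_ind: x => [|x x' IH IH'|d p].
- by rewrite raddf0 mulr0 mem0v.
- by rewrite raddfD mulrDr memvD.
rewrite piZ -scalerAr memvZ // -rmorphM.
case E: (parr p) => [|c s].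
  rewrite [_ * _]pathalg_mulpp /pmul_path (triv_pathE E) pcatp1.
  by case: eqP => _; rewrite ?memv_line // raddf0 mem0v.
have [q ->] := pelt_cons K E; have := no_c c.
by rewrite negbK mulrA rmorphM piI => /eqP->; rewrite mul0r mem0v.
Qed.

(** A product of non-composable arrows is 0 in the path algebra, and 0 is in [I]. *)
Lemma nonzero_prod_tgt (a b : arrow Q) : nonzero_prod I a b -> tgt a = src b.
Proof.
case: hA => _ _ piI; apply: contraNeq => nab; rewrite piI.
by rewrite [_ * _]pathalg_mulpp /pmul_path /pcat (negbTE nab) raddf0.
Qed.

End Quotient.

(** In an [f]-cycle with its first entry repeated at the end, each entry is followed by its image
    under [f], including across the closing step. *)
Lemma cyc_subpath_fcycle (Q : quiver) (f : arrow Q -> arrow Q) c a b :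
  fcycle f c -> cyc_subpath a b c = (a \in c) && (f a == b).
Proof.
move=> fc; rewrite /cyc_subpath.
have sorted_c : sorted (frel f) (c ++ take 1 c).
  by case: c fc => [|x s] //; rewrite /= take0 cats1.
apply/idP/andP => [/infixP[p [q E]]|[a_c /eqP fab]].
  split.
    have : a \in c ++ take 1 c by rewrite E !mem_cat mem_head orbT.
    by rewrite mem_cat => /orP[|/mem_take].
  by move: sorted_c; rewrite E => /cat_sorted2[_] /andP[].
case/splitPr: a_c sorted_c => p q; rewrite -catA cat_cons.
(* The repeated first entry ensures that something follows [a], even when [a] is the last entry of
   [c]. *)
case E: (q ++ _) => [|y t] /=.
  by move/(congr1 size): E; rewrite size_cat; case: (p) => [|? ?]; rewrite /= addnS.
case/cat_sorted2 => _ /andP[/eqP fay _]; rewrite -fay fab in E *.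
by apply/infixP; exists p, t.
Qed.

Section Permutation.
Variables (K : fieldType) (Q : quiver) (I : {pred pathalg K Q}).
Variable f : arrow Q -> arrow Q.
Hypotheses (f_inj : injective f) (fE : @nonzero_prod K Q I =2 frel f).

Let prod_f a : nonzero_prod I a (f a).
Proof. by rewrite fE /=. Qed.

Lemma phi_bij : bijective (@phi K Q I).
Proof.
exists (fun a => exist _ (a, f a) (prod_f a)) => // -[[a b] ab]; apply: val_inj.
have /eqP fab : f a == b by rewrite -[_ == _]fE.
by rewrite /phi /= fab.
Qed.

Lemma psi_bij : bijective (@psi K Q I).
Proof.
exists (fun b => exist (fun ab => nonzero_prod I ab.1 ab.2)
  (invF f_inj b, f (invF f_inj b)) (prod_f (invF f_inj b))) => [[[a b] ab]|b].
  have /eqP fab : f a == b by rewrite -[_ == _]fE.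
  by apply: val_inj; rewrite /psi /= -fab invF_f.
by rewrite /psi /= f_invF.
Qed.

Lemma special_cycles_orbits :
  (forall a b, nonzero_prod I a b -> tgt a = src b) ->
  exists S : {fset seq (arrow Q)}, special_cycles I S.
Proof.
(* Starting each orbit at its canonical root makes all arrows of an orbit yield the same list,
   rather than rotations of it; uniqueness of the cycle through an arrow is an equality of lists. *)
move=> prod_tgt; pose cyc a := orbit f (froot f a).
have mem_cyc a b : (a \in cyc b) = (froot f a == froot f b).
  have f_sym := fconnect_sym f_inj.
  by rewrite -fconnect_orbit -(root_connect f_sym) (root_root f_sym) eq_sym.
pose S := seq_fset tt [seq cyc a | a <- enum (arrow Q)].
have inS c : reflect (exists a, c = cyc a) (c \in S).
  rewrite seq_fsetE; apply: (iffP mapP) => [[a _ ->]|[a ->]]; exists a => //.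
  by rewrite mem_enum.
exists S; split=> [c /inS[a ->]|a|a b _].
- rewrite /basic_cycle orbit_uniq andbT /is_cycle; apply/andP; split.
    by apply: contraTneq (in_orbit f (froot f a)) => cyc0; rewrite -/(cyc a) cyc0.
  apply: sub_cycle (cycle_orbit f_inj _) => x y /eqP <-.
  by apply/eqP/prod_tgt.
- exists (cyc a); split=> [|c [/inS[b ->]]].
    by split; [apply/inS; exists a | rewrite mem_cyc].
  by rewrite mem_cyc /cyc => /eqP->.
rewrite fE /=; split=> [fab|[c /inS[d ->]]].
  exists (cyc a); first by apply/inS; exists a.
  by rewrite (cyc_subpath_fcycle _ _ (cycle_orbit f_inj _)) mem_cyc eqxx.
by rewrite (cyc_subpath_fcycle _ _ (cycle_orbit f_inj _)) => /andP[].
Qed.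

End Permutation.

Section Functional.
Variables (K : fieldType) (Q : quiver) (I : {pred pathalg K Q}).

Lemma phi_inj_functional : injective (@phi K Q I) ->
  forall a b b', nonzero_prod I a b -> nonzero_prod I a b' -> b = b'.
Proof.
move=> phiI a b b' ab ab'.
by have [] := phiI (exist _ (a, b) ab) (exist _ (a, b') ab') erefl.
Qed.

Lemma psi_inj_cofunctional : injective (@psi K Q I) ->
  forall a a' b, nonzero_prod I a b -> nonzero_prod I a' b -> a = a'.
Proof.
move=> psiI a a' b ab a'b.
by have [] := psiI (exist _ (a, b) ab) (exist _ (a', b) a'b) erefl.
Qed.

(** Only one cycle [c] of [S] passes through [a], and since [c] has no repeated arrow, the
    neighbours of [a] can only be [next c a] and [prev c a]. *)
Lemma special_cycles_condM (S : {fset seq (arrow Q)}) :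
  (forall a b, nonzero_prod I a b -> tgt a = src b) ->
  special_cycles I S -> condM I.
Proof.
move=> prod_tgt [basicS uniqS prodS].
have cycleP a b : nonzero_prod I a b ->
    exists c, [/\ c \in S, uniq c, a \in c & next c a = b].
  move=> ab; have [c cS] := (prodS a b (prod_tgt a b ab)).1 ab.
  have /andP[_ c_uniq] := basicS c cS.
  (* A list without repetitions is a cycle of its own successor function [next c]. *)
  rewrite (cyc_subpath_fcycle _ _ (cycle_next c_uniq)) => /andP[ac /eqP ncab].
  by exists c.
have cycle_eq a c c' : c \in S -> c' \in S -> a \in c -> a \in c' -> c = c'.
  move=> cS c'S ac ac'; have [d [_ dU]] := uniqS a.
  by rewrite -(dU c) // -(dU c').
move=> a; split=> [b b' /cycleP[c [cS _ ac <-]] /cycleP[c' [c'S _ ac' <-]]|].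
  by rewrite (cycle_eq a c c').
move=> b b' /cycleP[c [cS cU bc eb]] /cycleP[c' [c'S _ bc' eb']].
(* The cycles found contain the predecessors [b] and [b']; as [a] follows each of them, both cycles
   pass through [a] and so coincide. *)
have ac : a \in c by rewrite -eb mem_next.
have ac' : a \in c' by rewrite -eb' mem_next.
have E := cycle_eq a c c' cS c'S ac ac'; subst c'.
by rewrite -(prev_next cU b) eb -eb' prev_next.
Qed.

End Functional.

Theorem proposition3p4 (K : fieldType) (Q : quiver)
    (I : {pred pathalg K Q}) (hI : admissible I)
    (A : falgType K) (pi : {rmorphism pathalg K Q -> A})
    (hA : is_quotient I pi) (hind : indecomposable_alg A)
    (hsoc : arrow_free_socle pi) :
  [<-> condM I;
       condM' I;
       bijective (@phi K Q I);
       bijective (@psi K Q I);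
       exists S : {fset seq (arrow Q)}, special_cycles I S].
Proof.
have prod_r a := exists_nonzero_prod_right hA (hsoc a).2.
have prod_l a := exists_nonzero_prod_left hA (hsoc a).1.
tfae.
(* Existence comes from the arrow-free socle, uniqueness from (M). *)
- move=> M a; have [Mr Ml] := M a.
  by split; [case: (prod_r a) => b | case: (prod_l a) => b] => ab; exists b;
     split=> // b' ab'; [apply: Mr | apply: Ml].
- move=> M'; have [|f f_inj fE] := total_functional_rel prod_r prod_l.
    move=> a b b' ab ab'; have [[d [_ dU]] _] := M' a.
    by rewrite -(dU b) // -(dU b').
  exact: phi_bij fE.
(* Injectivity of [phi] says that the first arrow determines the second; totality on both sides then
   yields the permutation. *)
- move/bij_inj/phi_inj_functional=> fP.
  have [f f_inj fE] := total_functional_rel prod_r prod_l fP.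
  exact: psi_bij fE.
(* Dually, injectivity of [psi] says that the second arrow determines the first; the special cycles
   are the orbits of the resulting permutation. *)
- move/bij_inj/psi_inj_cofunctional=> fP.
  have [f f_inj fE] := total_cofunctional_rel prod_r prod_l fP.
  exact: special_cycles_orbits fE (nonzero_prod_tgt hA).
- by case=> S; apply: special_cycles_condM (nonzero_prod_tgt hA).
Qed.
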